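(* Let $1\le p<\infty$ and let $\mathbb{F}\in\{\mathbb{R},\mathbb{C}\}$. Then the multiplication in the Banach algebra $BV_p[0,1]$ is an open bilinear mapping. That is, for every pair $(F,G)\in (BV_p[0,1])^2$ and every $\varepsilon>0$ there exists $\delta>0$ such that \[ B(F G,\delta)\subset B(F,\varepsilon)\cdot B(G,\varepsilon):=\{c\, d:\ c\in B(F,\varepsilon),\ d\in B(G,\varepsilon)\}, \] where $B(a,r):=\{b\in BV_p[0,1]:\|a-b\|_{BV_p}<r\}$.
   Context: For $0\le\alpha\le\beta\le1$, a partition of $[\alpha,\beta]$ is a finite set $P=\{t_0,\dots,t_m\}$ with $\alpha=t_0<t_1<\dots<t_m=\beta$. For $1\le p<\infty$ and $f:[\alpha,\beta]\to\mathbb{F}$, $\mathbb{F}\in\{\mathbb{R},\mathbb{C}\}$, set $\operatorname{Var}_p(f,P,[\alpha,\beta]):=\sum_{j=1}^m|f(t_j)-f(t_{j-1})|^p$ and $\operatorname{Var}_p(f,[\alpha,\beta]):=\sup_P \operatorname{Var}_p(f,P,[\alpha,\beta])$ (the total Wiener $p$-variation). $BV_p[0,1]$ is the set of functions $f:[0,1]\to\mathbb{F}$ with $\operatorname{Var}_p(f,[0,1])<\infty$; it is a Banach algebra under pointwise multiplication with the norm $\|f\|_{BV_p}:=\|f\|_\infty+(\operatorname{Var}_p(f,[0,1]))^{1/p}$, where $\|f\|_\infty:=\sup_{x\in[0,1]}|f(x)|$. Multiplication in a Banach algebra $\mathcal{A}$ is locally open at $(a,b)\in\mathcal{A}^2$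 if for every $\varepsilon>0$ there is $\delta>0$ with $B_{\mathcal A}(ab,\delta)\subset B_{\mathcal A}(a,\varepsilon)\cdot B_{\mathcal A}(b,\varepsilon)$; it is an open bilinear mapping if it is locally open at every pair. *)

(* Defs.v *)
From Stdlib Require Import Reals Lra List.
Open Scope R_scope.

Inductive Fld := FR | FC.

Definition K (k : Fld) : Type :=
  match k with FR => R | FC => (R * R)%type end.

Definition kmul (k : Fld) : K k -> K k -> K k :=
  match k return K k -> K k -> K k with
  | FR => Rmult
  | FC => fun a b => (fst a * fst b - snd a * snd b, fst a * snd b + snd a * fst b)
  end.

Definition ksub (k : Fld) : K k -> K k -> K k :=
  match k return K k -> K k -> K k with
  | FR => Rminus
  | FC => fun a b => (fst a - fst b, snd a - snd b)
  end.

Definition kabs (k : Fld) : K k -> R :=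
  match k return K k -> R with
  | FR => Rabs
  | FC => fun a => sqrt (fst a * fst a + snd a * snd a)
  end.

(* x^y for x >= 0, y > 0, with the convention 0^y = 0
   (Stdlib's Rpower 0 y is exp 0 = 1, which is not what is wanted). *)
Definition rpow (x y : R) : R :=
  if Rle_dec x 0 then 0 else Rpower x y.

Definition partition01 (l : list R) : Prop :=
  (2 <= length l)%nat /\
  nth 0 l 0 = 0 /\
  nth (length l - 1) l 0 = 1 /\
  (forall i : nat, (S i < length l)%nat -> nth i l 0 < nth (S i) l 0).

Fixpoint varsum (k : Fld) (p : R) (f : R -> K k) (l : list R) : R :=
  match l with
  | a :: ((b :: _) as t) => rpow (kabs k (ksub k (f b) (f a))) p + varsum k p f t
  | _ => 0
  end.

Definition varset (k : Fld) (p : R) (f : R -> K k) : R -> Prop :=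
  fun v => exists l, partition01 l /\ v = varsum k p f l.

Definition inBV (k : Fld) (p : R) (f : R -> K k) : Prop :=
  exists M, forall v, varset k p f v -> v <= M.

Definition absset (k : Fld) (f : R -> K k) : R -> Prop :=
  fun v => exists x, 0 <= x <= 1 /\ v = kabs k (f x).

Definition fsub (k : Fld) (f g : R -> K k) : R -> K k := fun x => ksub k (f x) (g x).
Definition fmul (k : Fld) (f g : R -> K k) : R -> K k := fun x => kmul k (f x) (g x).

Definition bvnorm_is (k : Fld) (p : R) (f : R -> K k) (n : R) : Prop :=
  exists N V, is_lub (absset k f) N /\ is_lub (varset k p f) V /\
              n = N + rpow V (/ p).

Definition in_ball (k : Fld) (p : R) (a : R -> K k) (r : R) (b : R -> K k) : Prop :=
  inBV k p b /\ exists n, bvnorm_is k p (fsub k a b) n /\ n < r.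

(* Main.v *)
Require Import Defs.
From Stdlib Require Import Reals List.
From Stdlib Require Import Lra Lia Bool Classical ClassicalEpsilon.
Open Scope R_scope.

(* Two reductions.  First, (F, G) is replaced by a nearby pair (F', G') with F'G' = FG and
   max(|F'|, |G'|) bounded below: on a set S where |F|, |G| <= r, put F' = r and G' = FG / r.
   This is a small change because the p-variation of a function truncated at height r tends to 0
   with r.  To keep the number of passages in and out of S under control, S is entered at height
   r / 2 but left only at height r, so that each passage costs (r / 2)^p of the truncated variation.
   Second, if max(|F|, |G|) >= eta, then H near FG is factored as (H / G) * G where |F| is small
   and as F * (H / F) elsewhere, again with hysteresis; the number of switches depends on F and
   eta only, so delta can be chosen after it. *)

(** No continuity is available, and each passage in or out of S makes [F - F'] and [G - G'] jump by
    up to 2r. With W(r) the p-variation of max(|F|, |G|) truncated at r, there are at most 2 W(r) /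
    (r / 2)^p + 1 passages, so the jumps cost at most 4^p * (2 W(r) + (r / 2)^p): the powers of r
    cancel in the main term, and only W(r) -> 0 makes it small. For p > 1 the variation is not
    additive over intervals, so W(r) -> 0 cannot be read off from a decomposition of [0, 1]. The
    choice F' = r is harmless inside S. It is constant, so F - F' has the increments of F there.
    From |F|, |G| <= r follows |FG / r| <= r, and the product rule bounds the increments of FG / r
    by |dF| + |dG|: the division by the small number r loses nothing. The second reduction needs no
    small variation: its jumps have size of order |H - FG| / eta, their number is already fixed, and
    delta makes them small. *)

(** * Real powers with 0^y = 0 *)

Lemma Rabs_le_bounds (x y : R) : Rabs x <= y -> - y <= x <= y.
Proof. unfold Rabs; destruct Rcase_abs; lra. Qed.

Lemma rpow_0 (y : R) : rpow 0 y = 0.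
Proof. unfold rpow; destruct (Rle_dec 0 0); lra. Qed.

Lemma rpow_pos (x y : R) : 0 < x -> rpow x y = Rpower x y.
Proof. intros; unfold rpow; destruct (Rle_dec x 0); lra. Qed.

Lemma rpow_gt0 (x y : R) : 0 < x -> 0 < rpow x y.
Proof. intros; rewrite rpow_pos by assumption; apply exp_pos. Qed.

Lemma rpow_ge0 (x y : R) : 0 <= rpow x y.
Proof.
  unfold rpow; destruct (Rle_dec x 0); [lra|].
  left; apply exp_pos.
Qed.

Lemma rpow_le (x z y : R) : 0 <= y -> x <= z -> rpow x y <= rpow z y.
Proof.
  intros Hy Hxz; unfold rpow at 1; destruct (Rle_dec x 0); [apply rpow_ge0|].
  rewrite rpow_pos by lra; apply Rle_Rpower_l; lra.
Qed.

Lemma rpow_mul (x z y : R) : 0 <= x -> 0 <= z -> rpow (x * z) y = rpow x y * rpow z y.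
Proof.
  intros [Hx|<-] [Hz|<-]; rewrite ?Rmult_0_l, ?Rmult_0_r, ?rpow_0; try lra.
  rewrite !rpow_pos by (try apply Rmult_lt_0_compat; assumption).
  symmetry; apply Rpower_mult_distr; assumption.
Qed.

Lemma rpow_rpow_inv (x y : R) : 0 <= x -> y <> 0 -> rpow (rpow x y) (/ y) = x.
Proof.
  intros [Hx|<-] Hy; [|now rewrite !rpow_0].
  rewrite (rpow_pos x), rpow_pos by (try apply exp_pos; assumption).
  rewrite Rpower_mult, Rinv_r, Rpower_1; auto.
Qed.

Lemma rpow_inv_rpow (x y : R) : 0 <= x -> y <> 0 -> rpow (rpow x (/ y)) y = x.
Proof.
  intros Hx Hy; rewrite <- (Rinv_inv y) at 2.
  apply rpow_rpow_inv; [assumption|]; now apply Rinv_neq_0_compat.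
Qed.

(** Since p >= 1, t^p = t * t^(p - 1) with a monotone second factor. This is what splits the
    variation of a function between its part above one level and its part below a lower one. *)
Lemma rpow_superadd (x z p : R) :
  1 <= p -> 0 <= x -> 0 <= z -> rpow x p + rpow z p <= rpow (x + z) p.
Proof.
  intros Hp [Hx|<-] [Hz|<-]; rewrite ?Rplus_0_l, ?Rplus_0_r, ?rpow_0; try lra.
  rewrite !rpow_pos by lra.
  assert (D : forall t, 0 < t -> Rpower t p = t * Rpower t (p - 1)).
  { intros t Ht; rewrite <- (Rpower_1 t) at 2 by assumption.
    rewrite <- Rpower_plus; f_equal; lra. }
  rewrite !D by lra.
  assert (Rpower x (p - 1) <= Rpower (x + z) (p - 1)) by (apply Rle_Rpower_l; lra).
  assert (Rpower z (p - 1) <= Rpower (x + z) (p - 1)) by (apply Rle_Rpower_l; lra).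
  nra.
Qed.

(** From x + z <= 2 max(x, z). The constant is not the optimal 2^(p - 1), but it needs no convexity;
    the lemma serves in place of Minkowski's inequality throughout. *)
Lemma rpow_add_le (x z p : R) :
  1 <= p -> 0 <= x -> 0 <= z -> rpow (x + z) p <= rpow 2 p * (rpow x p + rpow z p).
Proof.
  intros Hp Hx Hz.
  assert (H : rpow (x + z) p <= rpow (2 * Rmax x z) p).
  { apply rpow_le; [lra|]; unfold Rmax; destruct (Rle_dec x z); lra. }
  assert (0 <= Rmax x z) by (unfold Rmax; destruct (Rle_dec x z); lra).
  rewrite rpow_mul in H by lra.
  apply (Rle_trans _ _ _ H), Rmult_le_compat_l; [apply rpow_ge0|].
  pose proof (rpow_ge0 x p); pose proof (rpow_ge0 z p).
  unfold Rmax; destruct (Rle_dec x z); lra.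
Qed.

Lemma rpow_small (y e : R) : 0 < y -> 0 < e ->
  exists d, 0 < d /\ forall x, x <= d -> rpow x y <= e.
Proof.
  intros Hy He; exists (rpow e (/ y)); split; [now apply rpow_gt0|].
  intros x Hx; rewrite <- (rpow_inv_rpow e y) by lra; apply rpow_le; lra.
Qed.

(** Only a lower bound is wanted, so monotonicity reduces all [z >= x - d] to one point just below
    [x], where continuity of the power applies. *)
Lemma rpow_lower_cont (x y e : R) : 0 <= y -> 0 < e ->
  exists d, 0 < d /\ forall z, x - d <= z -> rpow x y - e <= rpow z y.
Proof.
  intros Hy He; destruct (Rle_dec x 0) as [Hx|Hx].
  { exists 1; split; [lra|]; intros z _.
    pose proof (rpow_ge0 z y); unfold rpow at 1; destruct (Rle_dec x 0); lra. }
  assert (C : continuity_pt (fun t => Rpower t y) x).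
  { apply derivable_continuous_pt; eexists.
    apply derivable_pt_lim_power; lra. }
  destruct (C e He) as [d [Hd C']].
  (* [x / 2] keeps the comparison point positive, where [rpow] is [Rpower]; [d / 2] puts it strictly
     inside the neighbourhood given by continuity. *)
  exists (Rmin (d / 2) (x / 2)).
  pose proof (Rmin_l (d / 2) (x / 2)); pose proof (Rmin_r (d / 2) (x / 2)).
  assert (Hm : 0 < Rmin (d / 2) (x / 2)) by (apply Rmin_pos; lra).
  split; [exact Hm|].
  set (m := Rmin (d / 2) (x / 2)) in *.
  intros z Hz; apply Rle_trans with (rpow (x - m) y); [|apply rpow_le; lra].
  rewrite !rpow_pos by lra.
  assert (K : Rabs (Rpower (x - m) y - Rpower x y) < e).
  { apply (C' (x - m)); split.
    - split; [exact I|lra].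
    - simpl; unfold R_dist; rewrite Rabs_left; lra. }
  apply Rabs_def2 in K; lra.
Qed.

(** * Sums over chains *)

Fixpoint path (a : R) (l : list R) : Prop :=
  match l with
  | nil => True
  | b :: t => a <= b <= 1 /\ path b t
  end.

Fixpoint psum (c : R -> R -> R) (a : R) (l : list R) : R :=
  match l with
  | nil => 0
  | b :: t => c a b + psum c b t
  end.

(* Chains start at 0, are only weakly increasing, and need not reach 1. *)
Definition psum_bound (c : R -> R -> R) (M : R) : Prop :=
  forall l, path 0 l -> psum c 0 l <= M.

Lemma path_weaken (a b : R) (l : list R) : b <= a -> path a l -> path b l.
Proof. destruct l; simpl; intuition lra. Qed.

Lemma psum_le (c c' : R -> R -> R) (a : R) (l : list R) :
  (forall x y, 0 <= x <= 1 -> 0 <= y <= 1 -> c x y <= c' x y) ->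
  0 <= a <= 1 -> path a l -> psum c a l <= psum c' a l.
Proof.
  intros Hc; revert a; induction l as [|b l IH]; simpl; intros a Ha Hl; [lra|].
  apply Rplus_le_compat; [apply Hc; lra|]; apply IH; [lra|tauto].
Qed.

Lemma psum_add (c c' : R -> R -> R) (a : R) (l : list R) :
  psum (fun x y => c x y + c' x y) a l = psum c a l + psum c' a l.
Proof. revert a; induction l as [|b l IH]; simpl; intros a; [lra|]; rewrite IH; lra. Qed.

Lemma psum_scal (k : R) (c : R -> R -> R) (a : R) (l : list R) :
  psum (fun x y => k * c x y) a l = k * psum c a l.
Proof. revert a; induction l as [|b l IH]; simpl; intros a; [lra|]; rewrite IH; lra. Qed.

Lemma psum_bound_le (c c' : R -> R -> R) (M : R) :
  (forall x y, 0 <= x <= 1 -> 0 <= y <= 1 -> c x y <= c' x y) ->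
  psum_bound c' M -> psum_bound c M.
Proof.
  intros Hc HM l Hl; apply Rle_trans with (2 := HM l Hl).
  apply psum_le; auto; lra.
Qed.

Lemma psum_bound_mono (c : R -> R -> R) (M M' : R) :
  M <= M' -> psum_bound c M -> psum_bound c M'.
Proof. intros H HM l Hl; specialize (HM l Hl); lra. Qed.

Lemma psum_bound_add (c c' : R -> R -> R) (M M' : R) :
  psum_bound c M -> psum_bound c' M' -> psum_bound (fun x y => c x y + c' x y) (M + M').
Proof.
  intros H H' l Hl; rewrite psum_add; specialize (H l Hl); specialize (H' l Hl); lra.
Qed.

Lemma psum_bound_scal (k : R) (c : R -> R -> R) (M : R) : 0 <= k ->
  psum_bound c M -> psum_bound (fun x y => k * c x y) (k * M).
Proof.
  intros Hk H l Hl; rewrite psum_scal; apply Rmult_le_compat_l; auto.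
Qed.

(** * Merging and thinning chains *)

(** A merge is kept as a relation that records the origin of every point, so that sums along [P],
    [L] and [S] can be compared by induction. The order of the points matters in [shuffle_path]
    only. *)
Inductive shuffle : list R -> list R -> list R -> Prop :=
| shuffle_nil : shuffle nil nil nil
| shuffle_l x P L S : shuffle P L S -> shuffle (x :: P) L (x :: S)
| shuffle_r x P L S : shuffle P L S -> shuffle P (x :: L) (x :: S).

Lemma shuffle_path (a : R) (P L : list R) :
  path a P -> path a L -> exists S, shuffle P L S /\ path a S.
Proof.
  revert a L; induction P as [|x P IHP]; intros a L HP.
  - clear HP; revert a; induction L as [|y L IHL]; simpl; intros a HL.
    + exists nil; split; [constructor|exact I].
    + destruct (IHL y) as [S [HS HS']]; [tauto|].
      exists (y :: S); split; [now constructor|simpl; tauto].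
  - revert a HP; induction L as [|y L IHL]; intros a HP HL.
    + destruct (IHP x nil) as [S [HS HS']]; [apply HP|exact I|].
      exists (x :: S); split; [now constructor|simpl in *; tauto].
    + destruct (Rle_dec x y) as [Hxy|Hxy].
      * destruct (IHP x (y :: L)) as [S [HS HS']]; [apply HP|simpl in *; intuition lra|].
        exists (x :: S); split; [now constructor|simpl in *; tauto].
      * destruct (IHL y) as [S [HS HS']]; [simpl in *; intuition lra|apply HL|].
        exists (y :: S); split; [now constructor|simpl in *; tauto].
Qed.

(** An inserted low point splits one increment into two that cost no less together, or, past the end
    of [P], adds a nonnegative term. *)
Lemma psum_shuffle_left (c : R -> R -> R) (low : R -> Prop) (P L S : list R) (x : R) :
  (forall a b, 0 <= c a b) ->
  (forall a z b, low z -> c a b <= c a z + c z b) ->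
  shuffle P L S -> Forall low L -> psum c x P <= psum c x S.
Proof.
  intros Hc Hz H; revert x; induction H as [|y P L S H IH|z P L S H IH]; intros x HL.
  - lra.
  - simpl; specialize (IH y HL); lra.
  - inversion HL; subst; simpl.
    specialize (IH z ltac:(assumption)).
    apply Rle_trans with (c x z + psum c z P); [|lra].
    destruct P as [|y P]; simpl; [specialize (Hc x z); lra|].
    specialize (Hz x z y ltac:(assumption)); lra.
Qed.

(** Each point of [P] inserted into [L] destroys at most one increment, worth at most [k]. *)
Lemma psum_shuffle_right (c : R -> R -> R) (k : R) (P L S : list R) (x : R) :
  (forall a b, 0 <= c a b <= k) ->
  shuffle P L S -> psum c x L <= psum c x S + INR (length P) * k.
Proof.
  intros Hc H; revert x; induction H as [|y P L S H IH|z P L S H IH]; intros x.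
  - simpl; lra.
  - change (length (y :: P)) with (Datatypes.S (length P)); rewrite S_INR; simpl.
    specialize (IH y); pose proof (Hc x y).
    apply Rle_trans with (psum c y L + k); [|lra].
    destruct L as [|z L]; simpl; [pose proof (Hc x x); lra|].
    pose proof (Hc x z); pose proof (Hc y z); lra.
  - simpl; specialize (IH z); lra.
Qed.

Lemma path_filter (low : R -> bool) (a : R) (l : list R) :
  path a l -> path a (filter low l).
Proof.
  revert a; induction l as [|b l IH]; simpl; intros a Hl; [exact I|].
  destruct (low b); simpl; intuition; apply IH, path_weaken with b; tauto.
Qed.

Lemma psum_filter (c : R -> R -> R) (low : R -> bool) (a : R) (l : list R) :
  (forall x y, 0 <= c x y) ->
  psum (fun x y => if low x && low y then c x y else 0) a l <= psum c a (filter low l).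
Proof.
  intros Hc; revert a; induction l as [|b l IH]; simpl; intros a; [lra|].
  destruct (low b) eqn:Hb; simpl.
  - specialize (IH b); pose proof (Hc a b).
    destruct (low a); simpl; lra.
  - rewrite andb_false_r; specialize (IH a).
    (* The term starting at the dropped point [b] is 0, since [b] is not low; starting from [a]
       instead can only increase it. *)
    apply Rle_trans with (2 := IH).
    destruct l as [|d l]; simpl; [lra|].
    rewrite Hb; simpl; pose proof (Hc a d); destruct (low a && low d); lra.
Qed.

(** * Variation below a small height *)

Lemma Rabs_max_sub (K u v : R) : 0 <= K -> 0 <= u -> 0 <= v ->
  Rabs (v - u) - K <= Rabs (Rmax 0 (v - K) - Rmax 0 (u - K)).
Proof.
  intros; unfold Rmax; destruct (Rle_dec 0 (v - K)), (Rle_dec 0 (u - K));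
  unfold Rabs; repeat destruct Rcase_abs; lra.
Qed.

(** The chain is fixed and finite, so [K0] may depend on it: every increment shrinks by at most [K],
    and the losses are budgeted by halving [e] along the chain. *)
Lemma soft_threshold_psum (p : R) (f : R -> R) (P : list R) (e a : R) :
  1 <= p -> (forall x, 0 <= f x) -> 0 < e ->
  exists K0, 0 < K0 /\ forall K, 0 <= K <= K0 ->
    psum (fun x y => rpow (Rabs (f y - f x)) p) a P - e <=
    psum (fun x y => rpow (Rabs (Rmax 0 (f y - K) - Rmax 0 (f x - K))) p) a P.
Proof.
  intros Hp Hf; revert e a; induction P as [|b P IH]; intros e a He.
  - exists 1; split; [lra|]; simpl; intros; lra.
  - destruct (IH (e / 2) b) as [K1 [HK1 H1]]; [lra|].
    destruct (rpow_lower_cont (Rabs (f b - f a)) p (e / 2)) as [d [Hd H2]]; [lra|lra|].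
    exists (Rmin K1 d); split; [now apply Rmin_pos|].
    intros K HK; pose proof (Rmin_l K1 d); pose proof (Rmin_r K1 d).
    simpl; specialize (H1 K ltac:(lra)).
    specialize (H2 (Rabs (Rmax 0 (f b - K) - Rmax 0 (f a - K)))).
    pose proof (Rabs_max_sub K (f a) (f b) ltac:(lra) (Hf a) (Hf b)).
    specialize (H2 ltac:(lra)); lra.
Qed.

(* Take a nearly optimal chain P for f.  It stays nearly optimal for (f - K)^+, K small, and
   inserting points where f <= K into P cannot decrease the sum of (f - K)^+.  As
   |df|^p >= |d(f - K)^+|^p + |d min(f, kappa)|^p, hardly any variation is left for min(f, kappa). *)
Lemma truncation_small (p : R) (f : R -> R) (M e : R) :
  1 <= p -> (forall x, 0 <= f x) ->
  psum_bound (fun x y => rpow (Rabs (f y - f x)) p) M -> 0 < e ->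
  exists k0, 0 < k0 /\ forall k, 0 < k <= k0 ->
    psum_bound (fun x y => rpow (Rabs (Rmin (f y) k - Rmin (f x) k)) p) e.
Proof.
  intros Hp Hf HM He.
  set (c := fun x y => rpow (Rabs (f y - f x)) p) in *.
  destruct (completeness (fun v => exists l, path 0 l /\ v = psum c 0 l)) as [V [HV1 HV2]].
  { exists M; intros v [l [Hl ->]]; auto. }
  { exists 0, nil; simpl; auto. }
  assert (HV : psum_bound c V) by (intros l Hl; apply HV1; eauto).
  assert (V0 : 0 <= V) by (apply (HV nil); exact I).
  (* The budget is four times [e / 4]: near-optimality of [P], passing to (f - K)^+ on [P], the
     points of [P] merged into the low part of [Q] ([B1]), and the pairs of [Q] that are not both
     low ([B2]). *)
  assert (exists P, path 0 P /\ V - e / 4 < psum c 0 P) as [P [HP HPV]].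
  { apply NNPP; intros N.
    assert (V <= V - e / 4); [|lra].
    apply HV2; intros v [l [Hl ->]]; apply Rnot_lt_le; intros L; apply N; eauto. }
  destruct (soft_threshold_psum p f P (e / 4) 0) as [K [HK HPK]]; [auto|auto|lra|].
  specialize (HPK K ltac:(lra)); fold c in HPK.
  set (cK := fun x y => rpow (Rabs (Rmax 0 (f y - K) - Rmax 0 (f x - K))) p) in *.
  set (n := INR (length P)).
  assert (Hn : 0 <= n) by apply pos_INR.
  destruct (rpow_small p (e / 4 / (n + 1))) as [k1 [Hk1 Hk1']]; [lra| |].
  { apply Rdiv_lt_0_compat; lra. }
  destruct (rpow_small p (e / 4 / (V + 1))) as [d [Hd Hd']]; [lra| |].
  { apply Rdiv_lt_0_compat; lra. }
  assert (HdK : 0 < d * K / 2) by nra.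
  exists (Rmin k1 (Rmin (K / 2) (d * K / 2))); split.
  { repeat apply Rmin_pos; lra. }
  intros k Hk.
  pose proof (Rmin_l k1 (Rmin (K / 2) (d * K / 2))).
  pose proof (Rmin_r k1 (Rmin (K / 2) (d * K / 2))).
  pose proof (Rmin_l (K / 2) (d * K / 2)).
  pose proof (Rmin_r (K / 2) (d * K / 2)).
  assert (B1 : n * rpow k p <= e / 4).
  { assert (H3 : rpow k p <= e / 4 / (n + 1)) by (apply Hk1'; lra).
    assert (H4 : rpow k p * (n + 1) <= e / 4).
    { apply Rmult_le_compat_r with (r := n + 1) in H3; [|lra].
      replace (e / 4) with (e / 4 / (n + 1) * (n + 1)) by (field; lra); exact H3. }
    pose proof (rpow_ge0 k p); lra. }
  set (rho := rpow (2 * k / K) p).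
  assert (B2 : rho * V <= e / 4).
  { assert (H3 : rho <= e / 4 / (V + 1)).
    { apply Hd'. apply Rmult_le_reg_r with (K / 2); [lra|].
      replace (2 * k / K * (K / 2)) with k by (field; lra); lra. }
    assert (H4 : rho * (V + 1) <= e / 4).
    { apply Rmult_le_compat_r with (r := V + 1) in H3; [|lra].
      replace (e / 4) with (e / 4 / (V + 1) * (V + 1)) by (field; lra); exact H3. }
    assert (0 <= rho) by apply rpow_ge0; lra. }
  set (ck := fun x y => rpow (Rabs (Rmin (f y) k - Rmin (f x) k)) p).
  set (low := fun x => if Rle_dec (f x) K then true else false).
  intros Q HQ.
  (* A pair that is not both low changes min(f, k) only if it joins a value above [K] to one below
     [k]. Then |df| >= K - k >= K / 2, while the truncation changes by at most [k]: hence the ratio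
     [2 * k / K] in [rho]. *)
  assert (E1 : psum ck 0 Q <=
      psum (fun x y => if low x && low y then ck x y else 0) 0 Q + rho * psum c 0 Q).
  { rewrite <- psum_scal, <- psum_add; apply psum_le; [|lra|exact HQ].
    intros x y _ _.
    assert (0 <= rho * c x y) by (apply Rmult_le_pos; apply rpow_ge0).
    destruct (low x && low y) eqn:El; [lra|].
    assert (Hbig : K < f x \/ K < f y).
    { unfold low in El; destruct (Rle_dec (f x) K), (Rle_dec (f y) K);
        simpl in El; try discriminate; lra. }
    destruct (Rle_dec k (f x)) as [Ex|Ex], (Rle_dec k (f y)) as [Ey|Ey].
    - unfold ck; rewrite !Rmin_right, Rminus_diag, Rabs_R0, rpow_0 by lra; lra.
    - rewrite Rplus_0_l; unfold rho, c, ck.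
      rewrite <- rpow_mul; [|apply Rmult_le_pos; [lra|left; now apply Rinv_0_lt_compat]|apply Rabs_pos].
      apply rpow_le; [lra|].
      apply Rle_trans with (2 * k / K * (K / 2)).
      + replace (2 * k / K * (K / 2)) with k by (field; lra).
        rewrite (Rmin_left (f y)), (Rmin_right (f x)) by lra.
        specialize (Hf y); unfold Rabs; destruct Rcase_abs; lra.
      + apply Rmult_le_compat_l; [apply Rmult_le_pos; [lra|left; now apply Rinv_0_lt_compat]|].
        unfold Rabs; destruct Rcase_abs; lra.
    - rewrite Rplus_0_l; unfold rho, c, ck.
      rewrite <- rpow_mul; [|apply Rmult_le_pos; [lra|left; now apply Rinv_0_lt_compat]|apply Rabs_pos].
      apply rpow_le; [lra|].
      apply Rle_trans with (2 * k / K * (K / 2)).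
      + replace (2 * k / K * (K / 2)) with k by (field; lra).
        rewrite (Rmin_left (f x)), (Rmin_right (f y)) by lra.
        specialize (Hf x); unfold Rabs; destruct Rcase_abs; lra.
      + apply Rmult_le_compat_l; [apply Rmult_le_pos; [lra|left; now apply Rinv_0_lt_compat]|].
        unfold Rabs; destruct Rcase_abs; lra.
    - lra. }
  assert (E2 : rho * psum c 0 Q <= rho * V).
  { apply Rmult_le_compat_l; [apply rpow_ge0|auto]. }
  pose proof (psum_filter ck low 0 Q ltac:(intros; apply rpow_ge0)) as E3.
  destruct (shuffle_path 0 P (filter low Q)) as [S [HS HS']]; [exact HP|now apply path_filter|].
  assert (E4 : psum cK 0 P <= psum cK 0 S).
  { apply psum_shuffle_left with (fun z => f z <= K) (filter low Q); auto.
    - intros; apply rpow_ge0.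
    - intros a z b Hz; unfold cK; rewrite (Rmax_left 0 (f z - K)) by lra.
      pose proof (Rmax_l 0 (f a - K)); pose proof (Rmax_l 0 (f b - K)).
      set (u := Rmax 0 (f a - K)) in *; set (v := Rmax 0 (f b - K)) in *.
      rewrite Rminus_0_r, Rminus_0_l, Rabs_Ropp, (Rabs_pos_eq u), (Rabs_pos_eq v) by lra.
      pose proof (rpow_ge0 u p); pose proof (rpow_ge0 v p).
      destruct (Rle_dec u v).
      + apply Rle_trans with (rpow v p); [|lra].
        apply rpow_le; [lra|]; rewrite Rabs_pos_eq; lra.
      + apply Rle_trans with (rpow u p); [|lra].
        apply rpow_le; [lra|]; rewrite Rabs_left; lra.
    - apply Forall_forall; intros z Hz; apply filter_In in Hz; destruct Hz as [_ Hz].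
      unfold low in Hz; destruct (Rle_dec (f z) K); [assumption|discriminate]. }
  assert (E5 : psum ck 0 (filter low Q) <= psum ck 0 S + n * rpow k p).
  { apply psum_shuffle_right; [|exact HS].
    intros a b; split; [apply rpow_ge0|]; apply rpow_le; [lra|].
    pose proof (Hf a); pose proof (Hf b).
    unfold Rmin; destruct (Rle_dec (f a) k), (Rle_dec (f b) k);
      unfold Rabs; destruct Rcase_abs; lra. }
  (* As [k < K], the functions (f - K)^+ and min(f, k) respond to disjoint ranges of values of [f],
     so their increments add up to at most |df|, and [rpow_superadd] applies. *)
  assert (E6 : psum cK 0 S + psum ck 0 S <= psum c 0 S).
  { rewrite <- psum_add; apply psum_le; [|lra|exact HS'].
    intros x y _ _; unfold cK, ck, c.
    eapply Rle_trans; [apply rpow_superadd; auto; apply Rabs_pos|].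
    apply rpow_le; [lra|].
    unfold Rmin, Rmax; destruct (Rle_dec (f x) k), (Rle_dec (f y) k),
      (Rle_dec 0 (f x - K)), (Rle_dec 0 (f y - K));
      unfold Rabs; repeat destruct Rcase_abs; lra. }
  specialize (HV S HS'); fold ck; lra.
Qed.

(** * Hysteresis *)

(* The points that f has entered through the level lo without having exceeded hi since. *)
Definition hyst (f : R -> R) (lo hi x : R) : Prop :=
  exists s, 0 <= s <= x /\ f s <= lo /\ forall r, s <= r <= x -> f r <= hi.

Definition hystb (f : R -> R) (lo hi x : R) : bool :=
  if excluded_middle_informative (hyst f lo hi x) then true else false.

Definition switch (chi : R -> bool) (x y : R) : R :=
  if Bool.eqb (chi x) (chi y) then 0 else 1.

Lemma hystb_true (f : R -> R) (lo hi x : R) : 0 <= x ->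
  hystb f lo hi x = true -> f x <= hi.
Proof.
  unfold hystb; destruct excluded_middle_informative as [[s [Hs [_ H]]]|]; [|discriminate].
  intros; apply H; lra.
Qed.

Lemma hystb_false (f : R -> R) (lo hi x : R) : 0 <= x -> lo <= hi ->
  hystb f lo hi x = false -> lo < f x.
Proof.
  unfold hystb; destruct excluded_middle_informative as [|N]; [discriminate|].
  intros Hx Hlh _; apply Rnot_le_lt; intros L; apply N; exists x; repeat split; try lra.
  intros r Hr; replace r with x by lra; lra.
Qed.

(** Entrances and exits alternate, so exits alone need counting; the extra 1 is an entrance before
    the first exit, possible only when the chain starts outside. *)
Lemma psum_switch (chi : R -> bool) (a : R) (l : list R) :
  psum (switch chi) a l <=
  2 * psum (fun x y => if chi x && negb (chi y) then 1 else 0) a l + (if chi a then 0 else 1).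
Proof.
  revert a; induction l as [|b l IH]; simpl; intros a; [destruct (chi a); lra|].
  specialize (IH b); unfold switch at 1.
  destruct (chi a), (chi b); simpl in *; lra.
Qed.

(** An exit between [x] and [y] yields an entrance point [s <= x] with [f s <= lo] and some [r] in
    [(x, y]] with [f r > hi]; the pair [s, r] carries a truncated increment of at least [hi - lo],
    and [L] collects these pairs. Since [s] may precede [x], the induction must know that [L] still
    lies after the previous [r]: this is the second clause, true because [f <= hi] on [[s, x]]. The
    increment leading to [s] is nonnegative and is dropped, hence the arbitrary [z]. *)
Lemma hyst_exits (p : R) (f : R -> R) (lo hi x : R) (l : list R) :
  1 <= p -> lo <= hi -> 0 <= x <= 1 -> path x l ->
  exists L, path 0 L /\ (forall r, 0 <= r <= x -> hi < f r -> path r L) /\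
    forall z, rpow (hi - lo) p *
      psum (fun x y => if hystb f lo hi x && negb (hystb f lo hi y) then 1 else 0) x l <=
      psum (fun x y => rpow (Rabs (Rmin (f y) hi - Rmin (f x) hi)) p) z L.
Proof.
  intros Hp Hlh; revert x; induction l as [|y l IH]; intros x Hx Hl.
  - exists nil; simpl; repeat split; intros; lra.
  - destruct Hl as [Hxy Hl]; destruct (IH y) as [L [L0 [L1 L2]]]; [lra|exact Hl|].
    simpl psum at 1.
    destruct (hystb f lo hi x && negb (hystb f lo hi y)) eqn:E.
    + apply andb_prop in E; destruct E as [E1 E2].
      unfold hystb in E1, E2.
      destruct (excluded_middle_informative (hyst f lo hi x)) as [[s [Hs [Hlo Hhi]]]|]; [|discriminate].
      destruct (excluded_middle_informative (hyst f lo hi y)) as [|N]; [discriminate|].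
      assert (exists r, s <= r <= y /\ hi < f r) as [r [Hr Hfr]].
      { apply NNPP; intros N'; apply N; exists s; repeat split; try lra.
        intros r Hr; apply Rnot_lt_le; intros L'; apply N'; eauto. }
      assert (x < r).
      { apply Rnot_le_lt; intros L'; specialize (Hhi r ltac:(lra)); lra. }
      exists (s :: r :: L); split; [|split].
      * simpl; repeat split; try lra. apply L1; lra.
      * intros r' Hr' Hf'; simpl.
        assert (r' < s).
        { apply Rnot_le_lt; intros L'; specialize (Hhi r' ltac:(lra)); lra. }
        repeat split; try lra. apply L1; lra.
      * intros z; simpl psum at 2; specialize (L2 r).
        rewrite (Rmin_right (f r) hi), (Rmin_left (f s) hi) by lra.
        pose proof (rpow_ge0 (Rabs (f s - Rmin (f z) hi)) p).
        assert (rpow (hi - lo) p <= rpow (Rabs (hi - f s)) p).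
        { apply rpow_le; [lra|]; rewrite Rabs_pos_eq; lra. }
        rewrite Rmult_plus_distr_l, Rmult_1_r; lra.
    + exists L; split; [|split]; auto.
      * intros r Hr; apply L1; lra.
      * intros z; rewrite Rplus_0_l; auto.
Qed.

Lemma hyst_switches (p : R) (f : R -> R) (lo hi W : R) :
  1 <= p -> lo < hi ->
  psum_bound (fun x y => rpow (Rabs (Rmin (f y) hi - Rmin (f x) hi)) p) W ->
  psum_bound (switch (hystb f lo hi)) (2 * (W / rpow (hi - lo) p) + 1).
Proof.
  intros Hp Hlh HW l Hl.
  destruct (hyst_exits p f lo hi 0 l) as [L [L0 [_ L2]]]; [lra|lra|lra|exact Hl|].
  specialize (L2 0); specialize (HW L L0).
  pose proof (rpow_gt0 (hi - lo) p ltac:(lra)).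
  eapply Rle_trans; [apply psum_switch|].
  apply Rplus_le_compat; [|destruct hystb; lra].
  apply Rmult_le_compat_l; [lra|].
  apply Rmult_le_reg_l with (rpow (hi - lo) p); [lra|].
  replace (rpow (hi - lo) p * (W / rpow (hi - lo) p)) with W by (field; lra); lra.
Qed.

(** * Scalars *)

Definition kzero (k : Fld) : K k := match k with FR => 0 | FC => (0, 0) end.

Definition kreal (k : Fld) (r : R) : K k := match k with FR => r | FC => (r, 0) end.

Definition kinv (k : Fld) : K k -> K k :=
  match k return K k -> K k with
  | FR => Rinv
  | FC => fun a => (fst a / (fst a * fst a + snd a * snd a),
                    - snd a / (fst a * fst a + snd a * snd a))
  end.

Definition kre (k : Fld) : K k -> R :=
  match k return K k -> R with FR => fun a => a | FC => fst end.

(** The value 0 over the reals lets one splitting into real and imaginary parts serve both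
    fields. *)
Definition kim (k : Fld) : K k -> R :=
  match k return K k -> R with FR => fun _ => 0 | FC => snd end.

Ltac kring k :=
  destruct k; simpl; intros;
  [ring | repeat match goal with a : (R * R)%type |- _ => destruct a end; simpl; f_equal; ring].

Lemma ksub_diag (k : Fld) : forall a, ksub k a a = kzero k.
Proof. kring k. Qed.

Lemma ksub_0_r (k : Fld) : forall a, ksub k a (kzero k) = a.
Proof. kring k. Qed.

Lemma ksub_sub (k : Fld) : forall a b c, ksub k (ksub k a c) (ksub k b c) = ksub k a b.
Proof. kring k. Qed.

Lemma kmulC (k : Fld) : forall a b, kmul k a b = kmul k b a.
Proof. kring k. Qed.

(** After squaring this is the Cauchy-Schwarz inequality, which comes from
    [(a * d - b * c)^2 >= 0]. *)
Lemma sqrt_norm_triangle (a b c d : R) :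
  sqrt ((a + c) * (a + c) + (b + d) * (b + d)) <= sqrt (a * a + b * b) + sqrt (c * c + d * d).
Proof.
  assert (H1 : 0 <= a * a + b * b) by nra.
  assert (H2 : 0 <= c * c + d * d) by nra.
  pose proof (sqrt_pos (a * a + b * b)); pose proof (sqrt_pos (c * c + d * d)).
  pose proof (sqrt_sqrt _ H1); pose proof (sqrt_sqrt _ H2).
  set (s := sqrt (a * a + b * b)) in *; set (t := sqrt (c * c + d * d)) in *.
  apply Rsqr_incr_0_var; [|lra].
  rewrite Rsqr_sqrt by (apply Rplus_le_le_0_compat; apply Rle_0_sqr); unfold Rsqr.
  assert (a * c + b * d <= s * t); [|nra].
  apply Rsqr_incr_0_var; [|nra]; unfold Rsqr.
  replace (s * t * (s * t)) with ((s * s) * (t * t)) by ring.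
  rewrite H3, H4; pose proof (Rle_0_sqr (a * d - b * c)); unfold Rsqr in *; nra.
Qed.

Lemma kabs_ge0 (k : Fld) : forall a, 0 <= kabs k a.
Proof. destruct k; simpl; intros; [apply Rabs_pos|apply sqrt_pos]. Qed.

Lemma kabs_0 (k : Fld) : kabs k (kzero k) = 0.
Proof.
  destruct k; simpl; [apply Rabs_R0|].
  rewrite Rmult_0_l, Rplus_0_r; apply sqrt_0.
Qed.

Lemma kabs_real (k : Fld) (r : R) : kabs k (kreal k r) = Rabs r.
Proof.
  destruct k; simpl; [reflexivity|].
  rewrite Rmult_0_l, Rplus_0_r; apply sqrt_Rsqr_abs.
Qed.

Lemma kabs_mul (k : Fld) : forall a b, kabs k (kmul k a b) = kabs k a * kabs k b.
Proof.
  destruct k; simpl; intros; [apply Rabs_mult|].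
  rewrite <- sqrt_mult by (apply Rplus_le_le_0_compat; apply Rle_0_sqr); f_equal; ring.
Qed.

Lemma kabs_sub_triangle (k : Fld) :
  forall a b c, kabs k (ksub k a c) <= kabs k (ksub k a b) + kabs k (ksub k b c).
Proof.
  destruct k; simpl; intros a b c.
  - replace (a - c) with ((a - b) + (b - c)) by ring; apply Rabs_triang.
  - replace (fst a - fst c) with ((fst a - fst b) + (fst b - fst c)) by ring.
    replace (snd a - snd c) with ((snd a - snd b) + (snd b - snd c)) by ring.
    apply sqrt_norm_triangle.
Qed.

Lemma kabs_sub_sym (k : Fld) : forall a b, kabs k (ksub k a b) = kabs k (ksub k b a).
Proof.
  destruct k; simpl; intros a b; [apply Rabs_minus_sym|]; f_equal; ring.
Qed.

Lemma kabs_sub_le (k : Fld) (a b : K k) : kabs k (ksub k a b) <= kabs k a + kabs k b.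
Proof.
  pose proof (kabs_sub_triangle k a (kzero k) b) as H.
  rewrite ksub_0_r, (kabs_sub_sym k (kzero k)), ksub_0_r in H; exact H.
Qed.

Lemma kabs_rev_triangle (k : Fld) (a b : K k) :
  Rabs (kabs k a - kabs k b) <= kabs k (ksub k a b).
Proof.
  pose proof (kabs_sub_triangle k a b (kzero k)) as H1.
  pose proof (kabs_sub_triangle k b a (kzero k)) as H2.
  rewrite !ksub_0_r in *; rewrite (kabs_sub_sym k b a) in H2.
  unfold Rabs; destruct Rcase_abs; lra.
Qed.

Lemma kre_le (k : Fld) : forall a b, Rabs (kre k a - kre k b) <= kabs k (ksub k a b).
Proof.
  destruct k; simpl; intros a b; [lra|].
  rewrite <- sqrt_Rsqr_abs; apply sqrt_le_1_alt.
  pose proof (Rle_0_sqr (snd a - snd b)); unfold Rsqr in *; lra.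
Qed.

Lemma kim_le (k : Fld) : forall a b, Rabs (kim k a - kim k b) <= kabs k (ksub k a b).
Proof.
  destruct k; simpl; intros a b; [rewrite Rminus_diag, Rabs_R0; apply Rabs_pos|].
  rewrite <- sqrt_Rsqr_abs; apply sqrt_le_1_alt.
  pose proof (Rle_0_sqr (fst a - fst b)); unfold Rsqr in *; lra.
Qed.

Lemma kabs_re_im (k : Fld) : forall a b,
  kabs k (ksub k a b) <= Rabs (kre k a - kre k b) + Rabs (kim k a - kim k b).
Proof.
  destruct k; simpl; intros a b; [rewrite Rminus_diag, Rabs_R0; lra|].
  pose proof (sqrt_norm_triangle (fst a - fst b) 0 0 (snd a - snd b)) as H.
  rewrite !Rplus_0_r, !Rplus_0_l, !Rmult_0_l, !Rplus_0_r, !Rplus_0_l in H.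
  rewrite <- !sqrt_Rsqr_abs; exact H.
Qed.

Lemma kabs_pos_norm (a : K FC) : 0 < kabs FC a -> 0 < fst a * fst a + snd a * snd a.
Proof.
  simpl; intros H; apply Rnot_le_lt; intros L; rewrite sqrt_neg_0 in H; lra.
Qed.

Lemma kmul_inv_cancel (k : Fld) :
  forall a b, 0 < kabs k b -> kmul k (kmul k a (kinv k b)) b = a.
Proof.
  destruct k; intros a b Hb.
  - simpl in *; field; intros ->; rewrite Rabs_R0 in Hb; lra.
  - apply kabs_pos_norm in Hb; destruct a, b; simpl in *; f_equal; field; lra.
Qed.

Lemma kabs_inv (k : Fld) (a : K k) : 0 < kabs k a -> kabs k (kinv k a) = / kabs k a.
Proof.
  intros Ha; apply Rmult_eq_reg_r with (kabs k a); [|lra].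
  rewrite Rinv_l by lra; rewrite <- kabs_mul.
  pose proof (kmul_inv_cancel k (kreal k 1) a Ha) as H.
  replace (kmul k (kreal k 1) (kinv k a)) with (kinv k a) in H by (revert a Ha H; kring k).
  rewrite H, kabs_real, Rabs_R1; reflexivity.
Qed.

(** The error made in a factor is the error made in the product, divided by the other factor; so
    [quotient_small] can be applied to FG - H. *)
Lemma kquot_sub (k : Fld) : forall F H G, 0 < kabs k G ->
  ksub k F (kmul k H (kinv k G)) = kmul k (ksub k (kmul k F G) H) (kinv k G).
Proof.
  destruct k; intros F H G HG.
  - simpl in *; field; intros ->; rewrite Rabs_R0 in HG; lra.
  - apply kabs_pos_norm in HG; destruct F, H, G; simpl in *; f_equal; field; lra.
Qed.

Lemma kmul_sub_le (k : Fld) (a b a' b' : K k) :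
  kabs k (ksub k (kmul k a b) (kmul k a' b')) <=
  kabs k a * kabs k (ksub k b b') + kabs k (ksub k a a') * kabs k b'.
Proof.
  eapply Rle_trans; [apply (kabs_sub_triangle k _ (kmul k a b'))|].
  rewrite <- !kabs_mul; apply Req_le; f_equal; f_equal; [revert a b b'|revert a a' b']; kring k.
Qed.

Lemma kinv_sub_le (k : Fld) (g g' : K k) (r : R) :
  0 < r -> r <= kabs k g -> r <= kabs k g' ->
  kabs k (ksub k (kinv k g) (kinv k g')) <= / r * / r * kabs k (ksub k g g').
Proof.
  intros Hr Hg Hg'.
  replace (ksub k (kinv k g) (kinv k g')) with
    (kmul k (kmul k (kinv k g) (kinv k g')) (ksub k g' g)).
  - rewrite !kabs_mul, !kabs_inv, (kabs_sub_sym k g') by lra.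
    apply Rmult_le_compat_r; [apply kabs_ge0|].
    apply Rmult_le_compat; try (left; apply Rinv_0_lt_compat; lra); apply Rinv_le_contravar; lra.
  - assert (H : 0 < kabs k g) by lra; assert (H' : 0 < kabs k g') by lra.
    clear Hr Hg Hg' r; revert g g' H H'; destruct k; intros g g' H H'.
    + simpl in *; field; split; intros ->; rewrite Rabs_R0 in *; lra.
    + apply kabs_pos_norm in H; apply kabs_pos_norm in H'.
      destruct g, g'; simpl in *; f_equal; field; lra.
Qed.

(** * Variation costs *)

Definition kcost (k : Fld) (p : R) (f : R -> K k) (x y : R) : R :=
  rpow (kabs k (ksub k (f y) (f x))) p.

(** A root-free substitute for a norm bound: the same [e] bounds the supremum and the p-variation
    itself. Roots are taken only in the passage from and to [in_ball]. *)
Definition small (k : Fld) (p : R) (f : R -> K k) (e : R) : Prop :=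
  (forall x, 0 <= x <= 1 -> kabs k (f x) <= e) /\ psum_bound (kcost k p f) e.

(** Meant for the difference [u] between a function and its modification on the set [chi]. A pair
    across the boundary has [u = 0] at one end, so it costs at most s^p and is charged to
    [switch chi]; pairs inside are charged to [tau]. *)
Lemma kcost_patched (k : Fld) (p s T N : R) (u : R -> K k) (chi : R -> bool) (tau : R -> R -> R) :
  1 <= p ->
  (forall x, 0 <= x <= 1 -> chi x = false -> u x = kzero k) ->
  (forall x, 0 <= x <= 1 -> chi x = true -> kabs k (u x) <= s) ->
  (forall x y, 0 <= x <= 1 -> 0 <= y <= 1 -> chi x = true -> chi y = true ->
     kcost k p u x y <= tau x y) ->
  (forall x y, 0 <= tau x y) ->
  psum_bound tau T -> psum_bound (switch chi) N ->
  psum_bound (kcost k p u) (T + rpow s p * N).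
Proof.
  intros Hp H0 Hs Ht Ht0 HT HN.
  eapply psum_bound_le;
    [|apply psum_bound_add; [exact HT|apply psum_bound_scal; [apply rpow_ge0|exact HN]]].
  intros x y Hx Hy; simpl; unfold switch; specialize (Ht0 x y).
  destruct (chi x) eqn:Ex, (chi y) eqn:Ey; simpl.
  - specialize (Ht x y Hx Hy Ex Ey); lra.
  - unfold kcost; rewrite (H0 y Hy Ey), kabs_sub_sym, ksub_0_r.
    assert (rpow (kabs k (u x)) p <= rpow s p); [|lra].
    apply rpow_le; [lra|auto].
  - unfold kcost; rewrite (H0 x Hx Ex), ksub_0_r.
    assert (rpow (kabs k (u y)) p <= rpow s p); [|lra].
    apply rpow_le; [lra|auto].
  - unfold kcost; rewrite (H0 x Hx Ex), (H0 y Hy Ey), ksub_0_r, kabs_0, rpow_0; lra.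
Qed.

(** Truncation is applied to the positive and negative parts of [f], and is inactive where |f| <= k.
    The majorant [tau] is small along every chain, so chains never have to be restricted to the low
    points. *)
Lemma low_pairs_real (p : R) (f : R -> R) (M e : R) :
  1 <= p -> psum_bound (fun x y => rpow (Rabs (f y - f x)) p) M -> 0 < e ->
  exists k0, 0 < k0 /\ forall k, 0 < k <= k0 -> exists tau,
    (forall x y, 0 <= tau x y) /\ psum_bound tau e /\
    forall x y, Rabs (f x) <= k -> Rabs (f y) <= k -> rpow (Rabs (f y - f x)) p <= tau x y.
Proof.
  intros Hp HM He.
  pose proof (rpow_gt0 2 p ltac:(lra)) as H2.
  set (e0 := e / (2 * rpow 2 p)).
  assert (He0 : 0 < e0) by (apply Rdiv_lt_0_compat; lra).
  assert (T : forall s, s = 1 \/ s = -1 -> exists k0, 0 < k0 /\ forall k, 0 < k <= k0 ->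
    psum_bound (fun x y => rpow (Rabs (Rmin (Rmax 0 (s * f y)) k - Rmin (Rmax 0 (s * f x)) k)) p) e0).
  { intros s Hs; apply truncation_small with (f := fun x => Rmax 0 (s * f x)) (M := M); auto.
    - intros x; apply Rmax_l.
    - revert HM; apply psum_bound_le; intros x y _ _; apply rpow_le; [lra|].
      unfold Rmax; destruct Hs as [-> | ->]; repeat destruct Rle_dec;
        unfold Rabs; repeat destruct Rcase_abs; lra. }
  destruct (T 1) as [k1 [Hk1 T1]]; [auto|].
  destruct (T (-1)) as [k2 [Hk2 T2]]; [auto|].
  exists (Rmin k1 k2); split; [now apply Rmin_pos|].
  intros k Hk; pose proof (Rmin_l k1 k2); pose proof (Rmin_r k1 k2).
  specialize (T1 k ltac:(lra)); specialize (T2 k ltac:(lra)).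
  eexists; split; [|split].
  2: { apply psum_bound_mono with (rpow 2 p * (e0 + e0)); [unfold e0; right; field; lra|].
       apply psum_bound_scal; [lra|]; apply psum_bound_add; [exact T1|exact T2]. }
  - intros x y; simpl; apply Rmult_le_pos; [lra|]; apply Rplus_le_le_0_compat; apply rpow_ge0.
  - intros x y Hx Hy; simpl.
    eapply Rle_trans; [|apply rpow_add_le; auto; apply Rabs_pos].
    apply rpow_le; [lra|].
    apply Rabs_le_bounds in Hx; apply Rabs_le_bounds in Hy.
    rewrite !Rmin_left by (unfold Rmax; destruct Rle_dec; lra).
    unfold Rmax; repeat destruct Rle_dec; unfold Rabs; repeat destruct Rcase_abs; lra.
Qed.

Lemma low_pairs (k : Fld) (p : R) (F : R -> K k) (M e : R) :
  1 <= p -> psum_bound (kcost k p F) M -> 0 < e ->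
  exists k0, 0 < k0 /\ forall r, 0 < r <= k0 -> exists tau,
    (forall x y, 0 <= tau x y) /\ psum_bound tau e /\
    forall x y, kabs k (F x) <= r -> kabs k (F y) <= r -> kcost k p F x y <= tau x y.
Proof.
  intros Hp HM He.
  pose proof (rpow_gt0 2 p ltac:(lra)) as H2.
  set (e0 := e / (2 * rpow 2 p)).
  assert (He0 : 0 < e0) by (apply Rdiv_lt_0_compat; lra).
  destruct (low_pairs_real p (fun x => kre k (F x)) M e0) as [k1 [Hk1 T1]]; auto.
  { revert HM; apply psum_bound_le; intros; apply rpow_le; [lra|apply kre_le]. }
  destruct (low_pairs_real p (fun x => kim k (F x)) M e0) as [k2 [Hk2 T2]]; auto.
  { revert HM; apply psum_bound_le; intros; apply rpow_le; [lra|apply kim_le]. }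
  exists (Rmin k1 k2); split; [now apply Rmin_pos|].
  intros r Hr; pose proof (Rmin_l k1 k2); pose proof (Rmin_r k1 k2).
  destruct (T1 r ltac:(lra)) as [t1 [P1 [B1 L1]]].
  destruct (T2 r ltac:(lra)) as [t2 [P2 [B2 L2]]].
  exists (fun x y => rpow 2 p * (t1 x y + t2 x y)); split; [|split].
  - intros x y; apply Rmult_le_pos; [lra|]; apply Rplus_le_le_0_compat; auto.
  - apply psum_bound_mono with (rpow 2 p * (e0 + e0)); [unfold e0; right; field; lra|].
    apply psum_bound_scal; [lra|]; now apply psum_bound_add.
  - intros x y Hx Hy.
    assert (Re : forall z, kabs k (F z) <= r -> Rabs (kre k (F z)) <= r).
    { intros z Hz; pose proof (kre_le k (F z) (kzero k)) as Q; rewrite ksub_0_r in Q.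
      replace (kre k (kzero k)) with 0 in Q by (destruct k; reflexivity).
      rewrite Rminus_0_r in Q; lra. }
    assert (Im : forall z, kabs k (F z) <= r -> Rabs (kim k (F z)) <= r).
    { intros z Hz; pose proof (kim_le k (F z) (kzero k)) as Q; rewrite ksub_0_r in Q.
      replace (kim k (kzero k)) with 0 in Q by (destruct k; reflexivity).
      rewrite Rminus_0_r in Q; lra. }
    specialize (L1 x y (Re _ Hx) (Re _ Hy)); specialize (L2 x y (Im _ Hx) (Im _ Hy)).
    unfold kcost; eapply Rle_trans; [apply rpow_le; [lra|apply kabs_re_im]|].
    eapply Rle_trans; [apply rpow_add_le; auto; apply Rabs_pos|].
    apply Rmult_le_compat_l; lra.
Qed.

Lemma kcost_ge0 (k : Fld) (p : R) (f : R -> K k) (x y : R) : 0 <= kcost k p f x y.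
Proof. apply rpow_ge0. Qed.

(** * Factorisation *)

Lemma max_kabs_sub_le (k : Fld) (a b a' b' : K k) :
  Rabs (Rmax (kabs k a) (kabs k b) - Rmax (kabs k a') (kabs k b')) <=
  Rmax (kabs k (ksub k a a')) (kabs k (ksub k b b')).
Proof.
  pose proof (kabs_rev_triangle k a a') as H1; pose proof (kabs_rev_triangle k b b') as H2.
  apply Rabs_le_bounds in H1; apply Rabs_le_bounds in H2; apply Rabs_le.
  unfold Rmax; repeat destruct Rle_dec; lra.
Qed.

Lemma refactor_nondegenerate (k : Fld) (p : R) (F G : R -> K k) (MF MG e : R) :
  1 <= p -> psum_bound (kcost k p F) MF -> psum_bound (kcost k p G) MG -> 0 < e ->
  exists eta F' G', 0 < eta /\
    (forall x, 0 <= x <= 1 -> kmul k (F' x) (G' x) = kmul k (F x) (G x)) /\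
    (forall x, 0 <= x <= 1 -> eta <= kabs k (F' x) \/ eta <= kabs k (G' x)) /\
    small k p (fsub k F F') e /\ small k p (fsub k G G') e.
Proof.
  intros Hp HF HG He.
  pose proof (rpow_gt0 2 p ltac:(lra)) as P2; pose proof (rpow_gt0 4 p ltac:(lra)) as P4.
  (* The cost inside S is at most [e0] for F - F' and 2^p (1 + 2^p) [e0] for G - G'; the passages
     add 3 * 4^p [e0] to each. *)
  set (C := 1 + rpow 2 p * (1 + rpow 2 p) + 3 * rpow 4 p).
  assert (HC : 0 < C) by (unfold C; nra).
  set (e0 := e / C).
  assert (He0 : 0 < e0) by (now apply Rdiv_lt_0_compat).
  assert (HeC : e = C * e0) by (unfold e0; field; lra).
  destruct (low_pairs k p F MF e0) as [k1 [Hk1 T1]]; auto.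
  destruct (low_pairs k p G MG e0) as [k2 [Hk2 T2]]; auto.
  set (m := fun x => Rmax (kabs k (F x)) (kabs k (G x))).
  destruct (truncation_small p m (MF + MG) e0) as [k3 [Hk3 T3]]; auto.
  { intros x; apply Rle_trans with (2 := Rmax_l _ _), kabs_ge0. }
  { eapply psum_bound_le; [|apply psum_bound_add; [exact HF|exact HG]].
    intros x y _ _; simpl; unfold kcost.
    eapply Rle_trans; [apply rpow_le; [lra|apply max_kabs_sub_le]|].
    pose proof (rpow_ge0 (kabs k (ksub k (F y) (F x))) p).
    pose proof (rpow_ge0 (kabs k (ksub k (G y) (G x))) p).
    unfold Rmax; destruct Rle_dec; lra. }
  destruct (rpow_small p e0) as [k4 [Hk4 T4]]; [lra|auto|].
  assert (exists r, 0 < r /\ r <= k1 /\ r <= k2 /\ r <= k3 /\ r <= k4 /\ 2 * r <= e)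
    as [r [Hr [R1 [R2 [R3 [R4 R5]]]]]].
  { exists (Rmin (Rmin k1 k2) (Rmin (Rmin k3 k4) (e / 2))); split.
    - repeat apply Rmin_pos; lra.
    - unfold Rmin; repeat destruct Rle_dec; lra. }
  destruct (T1 r ltac:(lra)) as [t1 [A1 [B1 C1]]]; clear T1.
  destruct (T2 r ltac:(lra)) as [t2 [A2 [B2 C2]]]; clear T2.
  specialize (T3 r ltac:(lra)).
  apply hyst_switches with (lo := r / 2) in T3; [|lra|lra].
  replace (r - r / 2) with (r / 2) in T3 by lra.
  set (chi := hystb m (r / 2) r) in *.
  pose proof (rpow_gt0 (r / 2) p ltac:(lra)) as Pr.
  specialize (T4 (r / 2) ltac:(lra)).
  (* A passage costs at most (2r)^p = 4^p (r / 2)^p, which cancels the denominator in their number;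
     the isolated 1 is absorbed through (r / 2)^p <= [e0], the reason for [k4]. *)
  assert (N : rpow (2 * r) p * (2 * (e0 / rpow (r / 2) p) + 1) <= 3 * rpow 4 p * e0).
  { replace (2 * r) with (4 * (r / 2)) by lra; rewrite rpow_mul by lra.
    replace (rpow 4 p * rpow (r / 2) p * (2 * (e0 / rpow (r / 2) p) + 1))
      with (rpow 4 p * (2 * e0 + rpow (r / 2) p)) by (field; lra).
    replace (3 * rpow 4 p * e0) with (rpow 4 p * (3 * e0)) by ring.
    apply Rmult_le_compat_l; lra. }
  assert (ST : forall x, 0 <= x <= 1 -> chi x = true -> kabs k (F x) <= r /\ kabs k (G x) <= r).
  { intros x Hx E; apply hystb_true in E; [|lra]; unfold m in E.
    pose proof (Rmax_l (kabs k (F x)) (kabs k (G x))).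
    pose proof (Rmax_r (kabs k (F x)) (kabs k (G x))); lra. }
  set (F' := fun x => if chi x then kreal k r else F x).
  set (G' := fun x => if chi x then kmul k (kreal k (/ r)) (kmul k (F x) (G x)) else G x).
  assert (Hir : kabs k (kreal k (/ r)) = / r).
  { rewrite kabs_real; apply Rabs_pos_eq; left; now apply Rinv_0_lt_compat. }
  assert (Hr1 : kabs k (kreal k r) = r).
  { rewrite kabs_real; apply Rabs_pos_eq; lra. }
  assert (Ir : 0 < / r) by (now apply Rinv_0_lt_compat).
  assert (UF : forall x, 0 <= x <= 1 -> chi x = true -> kabs k (fsub k F F' x) <= 2 * r).
  { intros x Hx E; destruct (ST x Hx E); unfold fsub, F'; rewrite E.
    eapply Rle_trans; [apply kabs_sub_le|]; lra. }
  assert (UG : forall x, 0 <= x <= 1 -> chi x = true -> kabs k (fsub k G G' x) <= 2 * r).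
  { intros x Hx E; destruct (ST x Hx E); unfold fsub, G'; rewrite E.
    eapply Rle_trans; [apply kabs_sub_le|].
    rewrite !kabs_mul, Hir.
    assert (/ r * (kabs k (F x) * kabs k (G x)) <= / r * (r * r)).
    { apply Rmult_le_compat_l; [lra|]; apply Rmult_le_compat; auto; apply kabs_ge0. }
    replace (/ r * (r * r)) with r in * by (field; lra); lra. }
  assert (ZF : forall x, chi x = false -> fsub k F F' x = kzero k).
  { intros x E; unfold fsub, F'; rewrite E; apply ksub_diag. }
  assert (ZG : forall x, chi x = false -> fsub k G G' x = kzero k).
  { intros x E; unfold fsub, G'; rewrite E; apply ksub_diag. }
  (* Inside S, [F'] is [r]; outside, hysteresis guarantees max(|F|, |G|) > r / 2 only. *)
  exists (r / 2), F', G'; repeat split; try lra.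
  - intros x Hx; unfold F', G'; destruct (chi x); [|reflexivity].
    generalize (kmul k (F x) (G x)); intros w; clear - Hr; destruct k; simpl in *.
    + field; lra.
    + destruct w; simpl; f_equal; field; lra.
  - intros x Hx; unfold F', G'; destruct (chi x) eqn:E; [left; lra|].
    apply hystb_false in E; [|lra|lra].
    unfold m, Rmax in E; destruct Rle_dec; lra.
  - intros x Hx; destruct (chi x) eqn:E; [specialize (UF x Hx E); lra|].
    rewrite (ZF x E), kabs_0; lra.
  - eapply psum_bound_mono; [|apply kcost_patched with (chi := chi) (s := 2 * r) (5 := A1)].
    6: exact B1. 6: exact T3.
    all: auto.
    + rewrite HeC; unfold C; nra.
    + intros x y Hx Hy Ex Ey; unfold kcost, fsub, F'; rewrite Ex, Ey, ksub_sub.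
      apply C1; apply ST; auto.
  - intros x Hx; destruct (chi x) eqn:E; [specialize (UG x Hx E); lra|].
    rewrite (ZG x E), kabs_0; lra.
  - eapply psum_bound_mono; [|apply kcost_patched with (chi := chi) (s := 2 * r)
      (tau := fun x y => rpow 2 p * (t1 x y + rpow 2 p * t2 x y))].
    6: { intros x y; specialize (A1 x y); specialize (A2 x y).
         apply Rmult_le_pos; [lra|]; apply Rplus_le_le_0_compat; [lra|].
         apply Rmult_le_pos; lra. }
    6: { apply psum_bound_scal; [lra|]; apply psum_bound_add; [exact B1|].
         apply psum_bound_scal; [lra|exact B2]. }
    6: exact T3.
    all: auto.
    + rewrite HeC; unfold C; nra.
    + intros x y Hx Hy Ex Ey; unfold kcost, fsub, G'; rewrite Ex, Ey.
      destruct (ST x Hx Ex) as [Fx Gx], (ST y Hy Ey) as [Fy Gy].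
      specialize (C1 x y Fx Fy); specialize (C2 x y Gx Gy); unfold kcost in C1, C2.
      set (dF := kabs k (ksub k (F y) (F x))) in *.
      set (dG := kabs k (ksub k (G y) (G x))) in *.
      assert (0 <= dF) by apply kabs_ge0; assert (0 <= dG) by apply kabs_ge0.
      (* One [dG] comes from [G] itself; [dF + dG] comes from FG / r by the product rule, the bounds
         |F|, |G| <= r cancelling the factor 1 / r. *)
      apply Rle_trans with (rpow (dF + 2 * dG) p).
      * apply rpow_le; [lra|].
        replace (ksub k (ksub k (G y) (kmul k (kreal k (/ r)) (kmul k (F y) (G y))))
                        (ksub k (G x) (kmul k (kreal k (/ r)) (kmul k (F x) (G x)))))
          with (ksub k (ksub k (G y) (G x))
                 (kmul k (kreal k (/ r)) (ksub k (kmul k (F y) (G y)) (kmul k (F x) (G x)))))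
          by (generalize (F x) (F y) (G x) (G y) (/ r); clear; kring k).
        eapply Rle_trans; [apply kabs_sub_le|]; fold dG; rewrite kabs_mul, Hir.
        assert (L : kabs k (ksub k (kmul k (F y) (G y)) (kmul k (F x) (G x))) <= r * (dF + dG)).
        { eapply Rle_trans; [apply kmul_sub_le|]; fold dF dG.
          pose proof (Rmult_le_compat_r dG _ _ ltac:(auto) Fy).
          pose proof (Rmult_le_compat_l dF _ _ ltac:(auto) Gx); lra. }
        apply Rmult_le_compat_l with (r := / r) in L; [|lra].
        replace (/ r * (r * (dF + dG))) with (dF + dG) in L by (field; lra); lra.
      * eapply Rle_trans; [apply rpow_add_le; lra|].
        apply Rmult_le_compat_l; [lra|]; rewrite rpow_mul by lra.
        apply Rplus_le_compat; [exact C1|]; apply Rmult_le_compat_l; lra.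
Qed.

(** Here [h] stands for the error FG - H and [u] for the resulting error of a factor. The point is
    the order of quantifiers: [d] depends on [g] only through [M], [r] and the switch bound [N], and
    not on [h]. *)
Lemma quotient_small (k : Fld) (p r M N e : R) (g : R -> K k) (chi : R -> bool) :
  1 <= p -> 0 < r -> 0 < e -> psum_bound (kcost k p g) M -> psum_bound (switch chi) N ->
  (forall x, 0 <= x <= 1 -> chi x = true -> r <= kabs k (g x)) ->
  exists d, 0 < d /\ forall h u, small k p h d ->
    (forall x, 0 <= x <= 1 ->
       u x = if chi x then kmul k (h x) (kinv k (g x)) else kzero k) ->
    small k p u e.
Proof.
  intros Hp Hr He HM HN Hg.
  pose proof (rpow_gt0 2 p ltac:(lra)) as P2.
  assert (Ir : 0 < / r) by (now apply Rinv_0_lt_compat).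
  pose proof (rpow_gt0 (/ r) p Ir) as Pr.
  assert (M0 : 0 <= M) by (apply (HM nil); exact I).
  assert (N0 : 0 <= N) by (apply (HN nil); exact I).
  (* The variation of [u] will be at most [a * d + rpow d p * b]: [a] stems from the variation of
     [h], and [b] from that of 1 / g and from the switches. *)
  set (a := rpow 2 p * rpow (/ r) p).
  set (b := rpow 2 p * rpow (/ r * / r) p * M + rpow (/ r) p * N).
  assert (Ha : 0 < a) by (apply Rmult_lt_0_compat; lra).
  assert (Hb : 0 <= b).
  { apply Rplus_le_le_0_compat; repeat apply Rmult_le_pos; auto; try lra; apply rpow_ge0. }
  destruct (rpow_small p (e / 2 / (b + 1))) as [d1 [Hd1 S1]]; [lra| |].
  { apply Rdiv_lt_0_compat; lra. }
  assert (exists d, 0 < d /\ d <= d1 /\ a * d <= e / 2 /\ d * / r <= e)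
    as [d [Hd [D1 [D2 D3]]]].
  { exists (Rmin d1 (Rmin (e / 2 / a) (e * r))).
    pose proof (Rmin_l d1 (Rmin (e / 2 / a) (e * r))).
    pose proof (Rmin_r d1 (Rmin (e / 2 / a) (e * r))).
    pose proof (Rmin_l (e / 2 / a) (e * r)); pose proof (Rmin_r (e / 2 / a) (e * r)).
    assert (0 < e / 2 / a) by (apply Rdiv_lt_0_compat; lra).
    assert (0 < e * r) by (apply Rmult_lt_0_compat; lra).
    set (d := Rmin d1 (Rmin (e / 2 / a) (e * r))) in *.
    split; [repeat apply Rmin_pos; lra|split; [lra|split]].
    - apply Rle_trans with (a * (e / 2 / a)); [apply Rmult_le_compat_l; lra|].
      right; field; lra.
    - apply Rle_trans with (e * r * / r); [apply Rmult_le_compat_r; lra|].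
      right; field; lra. }
  specialize (S1 d D1).
  assert (D4 : rpow d p * b <= e / 2).
  { apply Rmult_le_compat_r with (r := b + 1) in S1; [|lra].
    replace (e / 2 / (b + 1) * (b + 1)) with (e / 2) in S1 by (field; lra).
    pose proof (rpow_ge0 d p); lra. }
  exists d; split; [exact Hd|]; intros h u [Hh1 Hh2] Hu.
  assert (U : forall x, 0 <= x <= 1 -> chi x = true -> kabs k (u x) <= d * / r).
  { intros x Hx E; rewrite (Hu x Hx), E, kabs_mul.
    specialize (Hg x Hx E); rewrite kabs_inv by lra.
    apply Rmult_le_compat; auto; [apply kabs_ge0| |].
    - left; apply Rinv_0_lt_compat; lra.
    - apply Rinv_le_contravar; lra. }
  assert (Z : forall x, 0 <= x <= 1 -> chi x = false -> u x = kzero k).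
  { intros x Hx E; now rewrite (Hu x Hx), E. }
  split.
  - intros x Hx; destruct (chi x) eqn:E; [specialize (U x Hx E); lra|].
    rewrite (Z x Hx E), kabs_0; lra.
  - eapply psum_bound_mono; [|apply kcost_patched with (chi := chi) (s := d * / r)
      (tau := fun x y => rpow 2 p * (rpow (d * (/ r * / r)) p * kcost k p g x y
                                     + rpow (/ r) p * kcost k p h x y))].
    6: { intros x y; pose proof (kcost_ge0 k p g x y); pose proof (kcost_ge0 k p h x y).
         apply Rmult_le_pos; [lra|]; apply Rplus_le_le_0_compat; apply Rmult_le_pos; auto;
           apply rpow_ge0. }
    6: { apply psum_bound_scal; [lra|]; apply psum_bound_add;
         apply psum_bound_scal; try apply rpow_ge0; [exact HM|exact Hh2]. }
    6: exact HN.
    all: auto.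
    + rewrite !(rpow_mul d) by (try apply Rmult_le_pos; lra).
      unfold a, b in *.
      replace (rpow 2 p * (rpow d p * rpow (/ r * / r) p * M + rpow (/ r) p * d)
               + rpow d p * rpow (/ r) p * N)
        with (rpow d p * (rpow 2 p * rpow (/ r * / r) p * M + rpow (/ r) p * N)
              + rpow 2 p * rpow (/ r) p * d) by ring.
      lra.
    + intros x y Hx Hy Ex Ey; unfold kcost.
      rewrite (Hu x Hx), (Hu y Hy), Ex, Ey.
      pose proof (Hg x Hx Ex) as gx; pose proof (Hg y Hy Ey) as gy.
      set (dg := kabs k (ksub k (g y) (g x))); set (dh := kabs k (ksub k (h y) (h x))).
      assert (0 <= dg) by apply kabs_ge0; assert (0 <= dh) by apply kabs_ge0.
      assert (0 <= / r * / r) by (apply Rmult_le_pos; lra).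
      assert (0 <= d * (/ r * / r)) by (apply Rmult_le_pos; lra).
      rewrite <- !rpow_mul by lra.
      eapply Rle_trans; [|apply rpow_add_le; try apply Rmult_le_pos; lra].
      apply rpow_le; [lra|].
      eapply Rle_trans; [apply kmul_sub_le|]; fold dh.
      apply Rplus_le_compat.
      * rewrite (Rmult_assoc d); apply Rmult_le_compat; auto; try apply kabs_ge0.
        apply kinv_sub_le; auto.
      * rewrite Rmult_comm; apply Rmult_le_compat_r; auto.
        rewrite kabs_inv by lra; apply Rinv_le_contravar; lra.
Qed.

Lemma switch_negb (chi : R -> bool) (N : R) :
  psum_bound (switch chi) N -> psum_bound (switch (fun x => negb (chi x))) N.
Proof.
  apply psum_bound_le; intros x y _ _; unfold switch.
  destruct (chi x), (chi y); simpl; lra.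
Qed.

Lemma factor_nondegenerate (k : Fld) (p : R) (F G : R -> K k) (MF MG eta e : R) :
  1 <= p -> psum_bound (kcost k p F) MF -> psum_bound (kcost k p G) MG ->
  0 < eta -> (forall x, 0 <= x <= 1 -> eta <= kabs k (F x) \/ eta <= kabs k (G x)) ->
  0 < e ->
  exists d, 0 < d /\ forall H, small k p (fsub k (fmul k F G) H) d ->
    exists a b, small k p (fsub k F a) e /\ small k p (fsub k G b) e /\
      forall x, 0 <= x <= 1 -> H x = kmul k (a x) (b x).
Proof.
  intros Hp HF HG Heta Hnd He.
  set (f := fun x => kabs k (F x)).
  (* The upper level must lie below [eta], so that |F| <= eta / 2 forces |G| >= eta; the lower one
     must be positive, so that F can be inverted elsewhere. *)
  assert (HW : psum_bound (switch (hystb f (eta / 4) (eta / 2)))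
                 (2 * (MF / rpow (eta / 2 - eta / 4) p) + 1)).
  { apply hyst_switches; [lra|lra|].
    revert HF; apply psum_bound_le; intros x y _ _; apply rpow_le; [lra|].
    apply Rle_trans with (2 := kabs_rev_triangle k (F y) (F x)); fold (f x) (f y).
    unfold Rmin; repeat destruct Rle_dec; unfold Rabs; repeat destruct Rcase_abs; lra. }
  set (chi := hystb f (eta / 4) (eta / 2)) in *.
  assert (BG : forall x, 0 <= x <= 1 -> chi x = true -> eta / 4 <= kabs k (G x)).
  { intros x Hx E; apply hystb_true in E; [|lra]; unfold f in E.
    destruct (Hnd x Hx); lra. }
  assert (BF : forall x, 0 <= x <= 1 -> negb (chi x) = true -> eta / 4 <= kabs k (F x)).
  { intros x Hx E; apply negb_true_iff, hystb_false in E; [|lra|lra]; unfold f in E; lra. }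
  destruct (quotient_small k p (eta / 4) MG _ e G chi Hp ltac:(lra) He HG HW BG)
    as [d1 [Hd1 Q1]].
  destruct (quotient_small k p (eta / 4) MF _ e F (fun x => negb (chi x)) Hp ltac:(lra) He HF
    (switch_negb _ _ HW) BF) as [d2 [Hd2 Q2]].
  exists (Rmin d1 d2); split; [now apply Rmin_pos|].
  intros H [HH1 HH2]; pose proof (Rmin_l d1 d2); pose proof (Rmin_r d1 d2).
  exists (fun x => if chi x then kmul k (H x) (kinv k (G x)) else F x).
  exists (fun x => if chi x then G x else kmul k (H x) (kinv k (F x))).
  split; [|split].
  - apply (Q1 (fsub k (fmul k F G) H)).
    + split; [intros x Hx; specialize (HH1 x Hx); lra|].
      apply psum_bound_mono with (2 := HH2); lra.
    + intros x Hx; unfold fsub, fmul; destruct (chi x) eqn:E; [|apply ksub_diag].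
      apply kquot_sub; specialize (BG x Hx E); lra.
  - apply (Q2 (fsub k (fmul k F G) H)).
    + split; [intros x Hx; specialize (HH1 x Hx); lra|].
      apply psum_bound_mono with (2 := HH2); lra.
    + intros x Hx; unfold fsub, fmul; destruct (chi x) eqn:E; simpl; [apply ksub_diag|].
      rewrite (kmulC k (F x)); apply kquot_sub.
      specialize (BF x Hx); rewrite E in BF; specialize (BF eq_refl); lra.
  - intros x Hx; destruct (chi x) eqn:E.
    + symmetry; apply kmul_inv_cancel; specialize (BG x Hx E); lra.
    + symmetry; rewrite kmulC; apply kmul_inv_cancel.
      specialize (BF x Hx); rewrite E in BF; specialize (BF eq_refl); lra.
Qed.

(** * The BV_p norm *)

Lemma varsum_psum (k : Fld) (p : R) (f : R -> K k) (a : R) (l : list R) :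
  varsum k p f (a :: l) = psum (kcost k p f) a l.
Proof.
  revert a; induction l as [|b l IH]; intros a; [reflexivity|].
  change (varsum k p f (a :: b :: l)) with (kcost k p f a b + varsum k p f (b :: l)).
  now rewrite IH.
Qed.

Lemma increasing_path (a : R) (l : list R) :
  nth (length l) (a :: l) 0 = 1 ->
  (forall i, (S i < length (a :: l))%nat -> nth i (a :: l) 0 < nth (S i) (a :: l) 0) ->
  path a l /\ a <= 1.
Proof.
  revert a; induction l as [|b l IH]; intros a Hlast Hinc; [simpl in *; split; [exact I|lra]|].
  destruct (IH b) as [H1 H2]; [exact Hlast| |].
  - intros i Hi; apply (Hinc (S i)); simpl in *; lia.
  - pose proof (Hinc 0%nat ltac:(simpl; lia)) as H0; simpl in H0.
    simpl; repeat split; try lra; exact H1.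
Qed.

(** Repeated points cost nothing and are removed; a missing end point 1 is appended, which adds a
    nonnegative term. *)
Lemma path_increasing (c : R -> R -> R) (a : R) (l : list R) :
  (forall x y, 0 <= c x y) -> (forall x, c x x = 0) -> a <= 1 -> path a l ->
  exists t, nth (length t) (a :: t) 0 = 1 /\
    (forall i, (S i < length (a :: t))%nat -> nth i (a :: t) 0 < nth (S i) (a :: t) 0) /\
    psum c a l <= psum c a t.
Proof.
  intros Hc Hc0; revert a; induction l as [|b l IH]; intros a Ha Hl.
  - destruct Ha as [Ha|Ha].
    + exists (1 :: nil); split; [reflexivity|split].
      * intros [|i] Hi; simpl in *; [exact Ha|lia].
      * simpl; specialize (Hc a 1); lra.
    + exists nil; split; [exact Ha|split]; [intros i Hi; simpl in Hi; lia|simpl; lra].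
  - destruct Hl as [Hb Hl]; destruct (IH b ltac:(lra) Hl) as [t [T1 [T2 T3]]].
    destruct (proj1 Hb) as [Hab|Hab].
    + exists (b :: t); split; [exact T1|split].
      * intros [|i] Hi; [exact Hab|]; apply (T2 i); simpl in *; lia.
      * simpl; lra.
    + subst b; exists t; repeat split; auto; simpl; rewrite Hc0; lra.
Qed.

Lemma varset_bound_iff (k : Fld) (p : R) (f : R -> K k) (M : R) :
  (forall v, varset k p f v -> v <= M) <-> psum_bound (kcost k p f) M.
Proof.
  split.
  - intros H l Hl.
    destruct (path_increasing (kcost k p f) 0 l) as [t [T1 [T2 T3]]]; auto.
    + apply kcost_ge0.
    + intros x; unfold kcost; rewrite ksub_diag, kabs_0; apply rpow_0.
    + lra.
    + apply Rle_trans with (1 := T3), H; exists (0 :: t).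
      split; [|symmetry; apply varsum_psum].
      destruct t as [|b t]; [simpl in T1; lra|].
      repeat split; auto; simpl; lia.
  - intros H v [l [[P1 [P2 [P3 P4]]] ->]].
    destruct l as [|a l]; [simpl in P1; lia|].
    simpl in P2; subst a; rewrite varsum_psum; apply H.
    apply increasing_path; [|exact P4].
    rewrite <- P3; f_equal; simpl; lia.
Qed.

Lemma varset_inhabited (k : Fld) (p : R) (f : R -> K k) : exists v, varset k p f v.
Proof.
  exists (varsum k p f (0 :: 1 :: nil)), (0 :: 1 :: nil).
  split; [|reflexivity].
  repeat split; try (simpl; lia).
  intros [|i] Hi; simpl in *; [lra|lia].
Qed.

Lemma in_ball_small (k : Fld) (p r d : R) (f g : R -> K k) :
  1 <= p -> r <= d -> rpow r p <= d -> in_ball k p f r g -> small k p (fsub k f g) d.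
Proof.
  intros Hp Hr Hrp [_ [n [[N [V [[HN _] [[HV _] ->]]]] Hn]]].
  apply varset_bound_iff in HV.
  pose proof (rpow_ge0 V (/ p)) as HVp.
  assert (N0 : 0 <= N).
  { apply Rle_trans with (kabs k (fsub k f g 0)); [apply kabs_ge0|].
    apply HN; exists 0; split; [lra|reflexivity]. }
  assert (V0 : 0 <= V) by (apply (HV nil); exact I).
  split.
  - intros x Hx; apply Rle_trans with N; [apply HN; exists x; auto|lra].
  - apply psum_bound_mono with (2 := HV); apply Rle_trans with (2 := Hrp).
    rewrite <- (rpow_inv_rpow V p) by lra; apply rpow_le; lra.
Qed.

(** Apply [rpow_add_le] to g = f - (f - g). It keeps the modified functions and the final factors in
    BV_p. *)
Lemma kcost_bound_of_sub (k : Fld) (p M e : R) (f g : R -> K k) : 1 <= p ->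
  psum_bound (kcost k p f) M -> psum_bound (kcost k p (fsub k f g)) e ->
  psum_bound (kcost k p g) (rpow 2 p * (M + e)).
Proof.
  intros Hp Hf Hfg.
  eapply psum_bound_le;
    [|apply psum_bound_scal; [apply rpow_ge0|apply psum_bound_add; [exact Hf|exact Hfg]]].
  intros x y _ _; simpl; unfold kcost.
  eapply Rle_trans; [|apply rpow_add_le; auto; apply kabs_ge0].
  apply rpow_le; [lra|].
  eapply Rle_trans; [|apply kabs_sub_le].
  right; f_equal; unfold fsub; generalize (f x) (f y) (g x) (g y); kring k.
Qed.

Lemma small_in_ball (k : Fld) (p M e r : R) (f g : R -> K k) :
  1 <= p -> psum_bound (kcost k p f) M -> e + rpow e (/ p) < r ->
  small k p (fsub k f g) e -> in_ball k p f r g.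
Proof.
  intros Hp Hf Her [Hs1 Hs2].
  assert (Ip : 0 < / p) by (apply Rinv_0_lt_compat; lra).
  split.
  - eexists; apply varset_bound_iff, kcost_bound_of_sub with (3 := Hs2); eauto.
  - destruct (completeness (absset k (fsub k f g))) as [N HN].
    { exists e; intros v [x [Hx ->]]; auto. }
    { exists (kabs k (fsub k f g 0)), 0; split; [lra|reflexivity]. }
    destruct (completeness (varset k p (fsub k f g))) as [V HV].
    { exists e; intros v; apply varset_bound_iff; exact Hs2. }
    { apply varset_inhabited. }
    exists (N + rpow V (/ p)); split; [exists N, V; auto|].
    apply Rle_lt_trans with (2 := Her), Rplus_le_compat.
    + apply HN; intros v [x [Hx ->]]; auto.
    + apply rpow_le; [lra|]; apply HV; intros v; apply varset_bound_iff; exact Hs2.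
Qed.

Lemma small_trans (k : Fld) (p e e' : R) (f g h : R -> K k) :
  1 <= p -> 2 * e <= e' -> rpow 2 p * (e + e) <= e' ->
  small k p (fsub k f g) e -> small k p (fsub k g h) e -> small k p (fsub k f h) e'.
Proof.
  intros Hp H1 H2 [A1 A2] [B1 B2]; split.
  - intros x Hx; specialize (A1 x Hx); specialize (B1 x Hx); unfold fsub in *.
    pose proof (kabs_sub_triangle k (f x) (g x) (h x)); lra.
  - apply psum_bound_mono with (1 := H2).
    eapply psum_bound_le;
      [|apply psum_bound_scal; [apply rpow_ge0|apply psum_bound_add; [exact A2|exact B2]]].
    intros x y _ _; simpl; unfold kcost.
    eapply Rle_trans; [|apply rpow_add_le; auto; apply kabs_ge0].
    apply rpow_le; [lra|].
    rewrite (kabs_sub_sym k (fsub k g h y)).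
    eapply Rle_trans; [|apply kabs_sub_le].
    right; f_equal; unfold fsub; generalize (f x) (f y) (g x) (g y) (h x) (h y); kring k.
Qed.

Lemma small_ext (k : Fld) (p e : R) (f g : R -> K k) :
  (forall x, 0 <= x <= 1 -> f x = g x) -> small k p f e -> small k p g e.
Proof.
  intros E [H1 H2]; split.
  - intros x Hx; rewrite <- E; auto.
  - revert H2; apply psum_bound_le; intros x y Hx Hy; unfold kcost.
    rewrite (E x Hx), (E y Hy); lra.
Qed.

Theorem theorem1p1 :
  forall (k : Fld) (p : R), 1 <= p ->
  forall F G : R -> K k, inBV k p F -> inBV k p G ->
  forall eps : R, 0 < eps ->
  exists delta : R, 0 < delta /\
    forall H : R -> K k, in_ball k p (fmul k F G) delta H ->
      exists c d : R -> K k,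
        in_ball k p F eps c /\ in_ball k p G eps d /\
        forall x : R, 0 <= x <= 1 -> H x = kmul k (c x) (d x).
Proof.
  intros k p Hp F G [MF HF] [MG HG] eps Heps.
  assert (HF' : psum_bound (kcost k p F) MF) by (apply varset_bound_iff; exact HF).
  assert (HG' : psum_bound (kcost k p G) MG) by (apply varset_bound_iff; exact HG).
  clear HF HG.
  (* [small] at level [e2] then gives norm below [eps]. The error is shared by the two reductions,
     [e1] each; without roots the triangle inequality costs a factor 2^p, so [e1] must satisfy both
     2 [e1] <= [e2] and 2^p * 2 [e1] <= [e2]. *)
  assert (exists e2, 0 < e2 /\ e2 + rpow e2 (/ p) < eps) as [e2 [He2 He2']].
  { destruct (rpow_small (/ p) (eps / 3)) as [d [Hd Hd']]; [apply Rinv_0_lt_compat; lra|lra|].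
    exists (Rmin d (eps / 3)); split; [apply Rmin_pos; lra|].
    pose proof (Rmin_r d (eps / 3)); specialize (Hd' _ (Rmin_l d (eps / 3))); lra. }
  pose proof (rpow_gt0 2 p ltac:(lra)) as P2.
  set (e1 := e2 / (2 * (1 + rpow 2 p))).
  assert (He1 : 0 < e1) by (apply Rdiv_lt_0_compat; lra).
  assert (E : e2 = 2 * e1 + rpow 2 p * (e1 + e1)) by (unfold e1; field; lra).
  assert (Hpos : 0 < rpow 2 p * (e1 + e1)) by (apply Rmult_lt_0_compat; lra).
  destruct (refactor_nondegenerate k p F G MF MG e1) as
    [eta [F' [G' [Heta [Hprod [Hnd [SF SG]]]]]]]; auto.
  pose proof (kcost_bound_of_sub k p MF e1 F F' Hp HF' (proj2 SF)) as BF.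
  pose proof (kcost_bound_of_sub k p MG e1 G G' Hp HG' (proj2 SG)) as BG.
  destruct (factor_nondegenerate k p F' G' _ _ eta e1 Hp BF BG Heta Hnd He1) as [d [Hd Hfac]].
  destruct (rpow_small p d) as [d' [Hd' Hd'']]; [lra|exact Hd|].
  (* A norm below delta bounds the supremum by delta and the variation by delta^p; [d'] takes care
     of the second. *)
  exists (Rmin d d'); split; [now apply Rmin_pos|].
  intros H HH; apply (in_ball_small k p _ d) in HH; [|exact Hp|apply Rmin_l|apply Hd'', Rmin_r].
  destruct (Hfac H) as [a [b [Ha [Hb Hab]]]].
  { revert HH; apply small_ext; intros x Hx; unfold fsub, fmul; now rewrite Hprod. }
  exists a, b; split; [|split; [|exact Hab]].
  - apply small_in_ball with MF e2; auto.
    apply small_trans with e1 F'; auto; lra.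
  - apply small_in_ball with MG e2; auto.
    apply small_trans with e1 G'; auto; lra.
Qed.
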